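(* For all $n,s\in\mathbb{N}$ and every $p_{X,Y}\in\mathcal{E}[0,1]^2_n$ there exists a ReLU network $\Psi\in\mathcal{N}_{1,2}$ with connectivity $\mathcal{M}(\Psi)<88(n^2+ns)$ and depth $\mathcal{L}(\Psi)=s+5$ such that \[ W(\Psi\#U,\,p_{X,Y})\le\frac{2\sqrt2}{n2^s}. \]
   Context: $\mathcal{E}[0,1]^2_n$: densities $p(x,y)=\sum_{k_1,k_2=0}^{n-1}w_{k_1,k_2}\chi_{[k_1/n,(k_1+1)/n]\times[k_2/n,(k_2+1)/n]}(x,y)$ with all $w_{k_1,k_2}>0$ and $\sum w_{k_1,k_2}=n^2$. A ReLU network of depth $L\ge2$ is $\Phi=W_L\circ\rho\circ W_{L-1}\circ\cdots\circ\rho\circ W_1$ with affine $W_\ell(x)=A_\ell x+b_\ell$ and $\rho(x)=\max(x,0)$ componentwise; $\mathcal{L}(\Phi)=L$; $\mathcal{M}(\Phi)$ is the total number of nonzero entries of all $A_\ell,b_\ell$; $\mathcal{N}_{d,d'}$ is the set of such networks with input dimension $d$, output dimension $d'$. $U$ is uniform on $[0,1]$, $\#$ is push-forward, and $W$ is the 1-Wasserstein distance $W(\mu,\nu)=\inf_\pi\int|x-y|d\pi$ over couplings of $\mu,\nu$ with Euclidean norm. *)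

(* Defs.v *)
From HB Require Import structures.
From mathcomp Require Import all_boot all_order all_algebra.
From mathcomp Require Import all_classical all_reals all_analysis.
Set Implicit Arguments. Unset Strict Implicit. Unset Printing Implicit Defensive.
Import Order.TTheory GRing.Theory Num.Theory.
Import numFieldNormedType.Exports.
Local Open Scope classical_set_scope.
Local Open Scope ring_scope.

Record layer (R : realType) := Layer {
  lout : nat; lin : nat; lA : 'M[R]_(lout, lin); lb : 'cV[R]_lout }.

Definition apply_layer (R : realType) (l : layer R) (x : seq R) : seq R :=
  [seq \sum_(j < lin l) lA l i j * nth 0 x j + lb l i ord0 | i <- enum 'I_(lout l)].

Definition relu (R : realType) (x : R) : R := Num.max x 0.

Fixpoint realize (R : realType) (N : seq (layer R)) (x : seq R) : seq R :=
  match N with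
  | [::] => x
  | [:: l] => apply_layer l x
  | l :: N' => realize N' (map (@relu R) (apply_layer l x))
  end.

Fixpoint dims_ok (R : realType) (d : nat) (N : seq (layer R)) (d' : nat) : bool :=
  match N with
  | [::] => d == d'
  | l :: N' => (lin l == d) && dims_ok (lout l) N' d'
  end.

Definition is_net (R : realType) (d d' : nat) (N : seq (layer R)) : Prop :=
  (2 <= size N)%N /\ dims_ok d N d'.

Definition depth (R : realType) (N : seq (layer R)) : nat := size N.

Definition layer_nnz (R : realType) (l : layer R) : nat :=
  (\sum_(i < lout l) \sum_(j < lin l) (lA l i j != 0%R)
   + \sum_(i < lout l) (lb l i ord0 != 0%R))%N.

Definition connectivity (R : realType) (N : seq (layer R)) : nat :=
  \sum_(l <- N) layer_nnz l.

Definition realize12 (R : realType) (N : seq (layer R)) (t : R) : R * R :=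
  let y := realize N [:: t] in (nth 0 y 0, nth 0 y 1).

Definition unif01 (R : realType) : set R -> \bar R :=
  fun A => lebesgue_measure (A `&` `[0, 1]).

Definition hist_density (R : realType) (n : nat) (w : 'I_n -> 'I_n -> R)
  (z : R * R) : R :=
  \sum_(k1 < n) \sum_(k2 < n)
    w k1 k2 * \1_(`[k1%:R / n%:R, k1.+1%:R / n%:R] `*`
                  `[k2%:R / n%:R, k2.+1%:R / n%:R]) z.

Definition hist_measure (R : realType) (n : nat) (w : 'I_n -> 'I_n -> R)
  : set (R * R) -> \bar R :=
  fun A => (\int[(@lebesgue_measure R \x @lebesgue_measure R)%E]_(z in A)
              (hist_density w z)%:E)%E.

Definition eucl_dist (R : realType) (z : (R * R) * (R * R)) : R :=
  Num.sqrt ((z.1.1 - z.2.1) ^+ 2 + (z.1.2 - z.2.2) ^+ 2).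

Definition is_coupling (R : realType) (mu nu : set (R * R) -> \bar R)
  (P : probability ((R * R) * (R * R))%type R) : Prop :=
  (forall A, measurable A -> P (A `*` setT) = mu A) /\
  (forall B, measurable B -> P (setT `*` B) = nu B).

Definition wasserstein1 (R : realType) (mu nu : set (R * R) -> \bar R) : \bar R :=
  ereal_inf [set c | exists P : probability ((R * R) * (R * R))%type R,
     is_coupling mu nu P /\ c = (\int[P]_z (eucl_dist z)%:E)%E].

(* Main.v *)
Require Import Defs.
From HB Require Import structures.
From mathcomp Require Import all_boot all_order all_algebra.
From mathcomp Require Import all_classical all_reals all_analysis.
From mathcomp Require Import measurable_realfun.
From mathcomp Require Import ring lra zify.
Set Implicit Arguments. Unset Strict Implicit. Unset Printing Implicit Defensive.
Import Order.TTheory GRing.Theory Num.Theory.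
Import numFieldNormedType.Exports.
Local Open Scope classical_set_scope.
Local Open Scope ring_scope.

(** Let [M = 2 ^ (s + 1)].  The first output coordinate is the piecewise linear
    quantile function of the first marginal; the second one is, inside the
    [k]-th column, the conditional quantile function of that column composed
    with a sawtooth having [M] monotone branches.  The [k]-th sawtooth is fed
    with [clip (c k) (c k.+1) u], where [c] are the cumulative column masses;
    outside the column this is 0 or 1, where the sawtooth vanishes, so the
    contributions of the columns simply add up.

    Over each of the [n * M] vertical strips of width [1 / (n * M)] the second
    coordinate of the network has exactly the second marginal which the
    histogram has on that strip, and the histogram does not depend on the
    first coordinate inside the strip.  So resampling the first coordinate
    uniformly in its strip, while keeping the second one, turns the law of the
    network into the histogram, at a cost of at most [1 / (n * M)]. *)

(** * Layers with prescribed sparse rows, and the count of their nonzero entries *)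

Section SparseLayers.
Variable R : realType.
Implicit Types (x : seq R) (rows : nat -> seq (nat * R) * R).

Definition row_eval (r : seq (nat * R) * R) x : R :=
  \sum_(e <- r.1) e.2 * nth 0 x e.1 + r.2.

(** Row [i] is a list of pairs of a column and a coefficient, together with a bias. Pairs that
    repeat a column are added, so the list may contain duplicates. *)
Definition sparse_layer (m N : nat) rows : layer R :=
  @Layer R N m (\matrix_(i < N, j < m) \sum_(e <- (rows i).1 | e.1 == j) e.2)
    (\col_(i < N) (rows i).2).

(** Exchanging the two sums matches each pair with its column. A pair whose column is at least [m]
    has no place in the matrix, and [row_eval] reads the default 0 there because [size x <= m]. *)
Lemma apply_sparse_layer m N rows x : (size x <= m)%N ->
  apply_layer (sparse_layer m N rows) x = mkseq (fun i => row_eval (rows i) x) N.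
Proof.
move=> xm; rewrite /mkseq -val_enum_ord -map_comp; apply: eq_map => i /=.
rewrite mxE /row_eval; congr (_ + _).
under eq_bigr => j _ do rewrite mxE big_distrl /= big_mkcond /=.
rewrite exchange_big /=; apply: eq_bigr => e _.
have [em|me] := ltnP e.1 m.
  rewrite (bigD1 (Ordinal em)) //= eqxx big1 ?addr0 // => j.
  by rewrite -val_eqE /= eq_sym => /negbTE ->.
rewrite nth_default ?mulr0 ?(leq_trans xm) // big1 // => j _.
by case: eqP => // ej; move: me; rewrite ej leqNgt ltn_ord.
Qed.

(** A nonzero entry in column [j] requires a pair for [j], so a row has at most as many nonzero
    coefficients as pairs; the successor pays for the bias. *)
Lemma layer_nnz_sparse m N rows :
  (layer_nnz (sparse_layer m N rows) <= \sum_(i < N) (size (rows i).1).+1)%N.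
Proof.
rewrite /layer_nnz /= -big_split /=; apply: leq_sum => i _.
rewrite -[leqRHS]addn1 leq_add ?leq_b1 //.
apply: (@leq_trans (\sum_(j < m) count (fun e => e.1 == val j) (rows i).1)).
  apply: leq_sum => j _; rewrite mxE.
  have [|] := posnP (count (fun e => e.1 == val j) (rows i).1); last first.
    by move=> h; apply: leq_trans h; exact: leq_b1.
  move=> c0; rewrite -big_filter; move/eqP: c0.
  by rewrite -size_filter => /nilP ->; rewrite big_nil eqxx.
elim: (rows i).1 => [|e r IH] /=; first by rewrite big1.
rewrite big_split /= -add1n leq_add //.
have [em|me] := ltnP e.1 m.
  rewrite (bigD1 (Ordinal em)) //= eqxx big1 // => j.
  by rewrite -val_eqE /= eq_sym => /negbTE ->.
rewrite big1 // => j _.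
by case: eqP => // ej; move: me; rewrite ej leqNgt ltn_ord.
Qed.

Lemma layer_nnz_sparse_le m N rows b :
  (forall i, (i < N)%N -> (size (rows i).1 < b)%N) ->
  (layer_nnz (sparse_layer m N rows) <= N * b)%N.
Proof.
move=> rb; apply: leq_trans (layer_nnz_sparse _ _ _) _.
by rewrite -[N in (N * b)%N]card_ord -sum_nat_const; apply: leq_sum => i _; exact: rb.
Qed.

Lemma sum_iota n (F : nat -> R) : \sum_(i <- iota 0 n) F i = \sum_(i < n) F i.
Proof. by rewrite -(big_mkord predT) /index_iota subn0. Qed.

Lemma realize_cons (l : layer R) N x : (0 < size N)%N ->
  realize (l :: N) x = realize N (map (@relu R) (apply_layer l x)).
Proof. by case: N. Qed.

Lemma dims_ok_cat d d' d'' (N N' : seq (layer R)) :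
  dims_ok d N d' -> dims_ok d' N' d'' -> dims_ok d (N ++ N') d''.
Proof.
elim: N d => [|l N IH] d /=; first by move=> /eqP ->.
by case/andP => -> /= /IH; apply.
Qed.

End SparseLayers.

(** * Ramps, staircases and iterated tent maps *)

Section PiecewiseLinear.
Variable R : realType.
Implicit Types (a b t h : R) (c : nat -> R).

(** For [a < b], the ramp that is 0 up to [a], affine between, and 1 from [b] on, as a combination
    of two hinges. *)
Definition clip a b t : R := (relu (t - a) - relu (t - b)) / (b - a).

(** For strictly increasing [c] this is the piecewise linear map that takes the knot [c k] to [k].
    With cumulative masses as knots it is a quantile function, up to the factor [n]. *)
Definition staircase c (n : nat) t : R := \sum_(k < n) clip (c k) (c k.+1) t.

(** On the unit interval: slope 2 up to the value 1 at 1/2, then slope -2 back to 0. *)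
Definition tent h : R := 2 * relu h - 4 * relu (h - 2^-1).

Lemma relu_id t : 0 <= t -> relu t = t.
Proof. by move=> t0; rewrite /relu max_l. Qed.

Lemma relu_eq0 t : t <= 0 -> relu t = 0.
Proof. by move=> t0; rewrite /relu max_r. Qed.

Lemma clip_ge0 a b t : a < b -> 0 <= clip a b t.
Proof.
move=> ab; rewrite /clip divr_ge0 ?subr_ge0 ?(ltW ab) //.
by rewrite /relu ge_max !le_max lerD2l lerN2 (ltW ab) lexx orbT.
Qed.

Lemma clip_lt a b t : a < b -> t <= a -> clip a b t = 0.
Proof.
by move=> ab ta; rewrite /clip !relu_eq0 ?subrr ?mul0r // subr_le0 // ltW // (le_lt_trans ta).
Qed.

Lemma clip_gt a b t : a < b -> b <= t -> clip a b t = 1.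
Proof.
move=> ab bt; rewrite /clip !relu_id ?subr_ge0 //; last by rewrite ltW // (lt_le_trans ab).
have : b - a != 0 by rewrite subr_eq0 gt_eqF.
by move=> ?; field.
Qed.

Lemma clip_mid a b t : a < b -> 0 <= t <= 1 -> clip a b (a + (b - a) * t) = t.
Proof.
move=> ab /andP[t0 t1]; have ba : 0 < b - a by rewrite subr_gt0.
rewrite /clip relu_id; last by rewrite addrAC subrr add0r mulr_ge0 // ltW.
rewrite relu_eq0; last by nra.
by field; rewrite gt_eqF.
Qed.

Lemma tent0 : tent 0 = 0.
Proof. by rewrite /tent !relu_eq0 ?mulr0 ?subr0 //; lra. Qed.

Lemma tent1 : tent 1 = 0.
Proof. by rewrite /tent !relu_id //; lra. Qed.

Lemma iter_tent0 m : iter m tent 0 = 0.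
Proof. by elim: m => //= m ->; exact: tent0. Qed.

(** Induction on [m], peeling off the innermost tent. On the left half the tent doubles the argument
    and branch [j] stays branch [j]. On the right half it also reflects: branch [j] becomes branch
    [2 ^ m.+1 - j.+1] with [t] replaced by [1 - t], and the parity flips because [2 ^ m.+1] is
    even. *)
Lemma iter_tentE m j t : (j < 2 ^ m)%N -> 0 <= t <= 1 ->
  iter m tent ((j%:R + t) / 2 ^+ m) = if odd j then 1 - t else t.
Proof.
elim: m j t => [|m IH] j t.
  by rewrite expn0 ltnS leqn0 => /eqP -> _; rewrite /= add0r expr0 divr1.
move=> jm /andP[t0 t1]; rewrite iterSr.
have e0 : 0 < 2 ^+ m :> R by rewrite exprn_gt0.
have [jm'|mj] := ltnP j (2 ^ m).
  rewrite -(IH _ t) ?t0 //; congr iter.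
  have : (j.+1%:R : R) <= 2 ^+ m by rewrite -natrX ler_nat.
  rewrite -natr1 => jR; rewrite /tent relu_id; last by rewrite divr_ge0 // ?addr_ge0 // exprn_ge0.
  rewrite relu_eq0; first by rewrite exprS; field; rewrite gt_eqF.
  by rewrite subr_le0 exprS ler_pdivrMr ?mulr_gt0 //; lra.
pose j' := (2 ^ m.+1 - j.+1)%N.
have E : iter m tent ((j'%:R + (1 - t)) / 2 ^+ m) = if odd j' then t else 1 - t.
  rewrite IH; first by rewrite opprB addrC subrK.
    by rewrite /j' expnS; move: mj jm; rewrite expnS; lia.
  by lra.
have oj : odd j' = ~~ odd j by rewrite /j' oddB // oddX /=.
rewrite oj in E; transitivity (if ~~ odd j then t else 1 - t); last by case: (odd j).
rewrite -E; congr iter.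
have jR : (2 ^+ m : R) <= j%:R by rewrite -natrX ler_nat.
have jR' : (j.+1%:R : R) <= 2 ^+ m.+1 by rewrite -natrX ler_nat.
have j'E : j'%:R = 2 ^+ m.+1 - j.+1%:R :> R by rewrite /j' natrB // natrX.
rewrite /tent relu_id; last by rewrite divr_ge0 // ?addr_ge0 // exprn_ge0.
rewrite relu_id; last by rewrite subr_ge0 exprS ler_pdivlMr ?mulr_gt0 //; lra.
by rewrite j'E -natr1 exprS; field; rewrite gt_eqF.
Qed.

Section Staircase.
Variables (c : nat -> R) (n : nat).
Hypothesis cS : forall k, c k < c k.+1.

Lemma strict_incr_le i j : (i <= j)%N -> c i <= c j.
Proof.
move/subnKC <-; elim: (j - i)%N => [|m IH]; first by rewrite addn0.
by rewrite addnS (le_trans IH) // ltW.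
Qed.

Lemma mid_itv k t : 0 <= t <= 1 ->
  c k <= c k + (c k.+1 - c k) * t <= c k.+1.
Proof. by move=> /andP[t0 t1]; have := cS k; nra. Qed.

(** The point lies between [c k] and [c k.+1], hence past the end of every earlier ramp and before
    the start of every later one. *)
Lemma clip_mid_neq j k t : 0 <= t <= 1 -> j != k ->
  clip (c j) (c j.+1) (c k + (c k.+1 - c k) * t) = (j < k)%:R.
Proof.
move=> /(@mid_itv k)/andP[h1 h2] jk; have [lt|le] := ltnP j k.
  by rewrite clip_gt // (le_trans _ h1) // strict_incr_le.
rewrite clip_lt // (le_trans h2) // strict_incr_le //.
by rewrite ltn_neqAle eq_sym jk.
Qed.

Lemma staircase_mid k t : (k < n)%N -> 0 <= t <= 1 ->
  staircase c n (c k + (c k.+1 - c k) * t) = k%:R + t.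
Proof.
move=> kn t01; rewrite /staircase (bigD1 (Ordinal kn)) //= clip_mid //.
rewrite addrC; congr (_ + _).
under eq_bigr => j jk.
  rewrite clip_mid_neq //; over.
rewrite -natr_sum; congr (_%:R).
have -> : (\sum_(i < n | i != Ordinal kn) (i < k) = \sum_(i < n | (i < k)%N) 1)%N.
  rewrite [RHS]big_mkcond /= [LHS]big_mkcond /=; apply: eq_bigr => i _.
  by rewrite -val_eqE /= ltn_neqAle; case: eqP.
by rewrite -(big_ord_widen n (fun=> 1%N) (ltnW kn)) sum1_card card_ord.
Qed.

Lemma staircase_start t : t <= c 0 -> staircase c n t = 0.
Proof.
move=> t0; rewrite /staircase big1 // => k _; apply: clip_lt => //.
by rewrite (le_trans t0) // strict_incr_le.
Qed.

End Staircase.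

Lemma staircase_ge0 c n t : (forall k, c k < c k.+1) -> 0 <= staircase c n t.
Proof. by move=> cS; apply: sumr_ge0 => k _; exact: clip_ge0. Qed.

End PiecewiseLinear.

(** * The network: its layers, its closed form and its size *)

Section Network.
Variables (R : realType) (n : nat) (c : nat -> R) (d : nat -> nat -> R).
Hypothesis n_gt0 : (0 < n)%N.
Hypothesis cS : forall k, c k < c k.+1.
Implicit Types (h : nat -> R) (x u : R).

Definition hinge_layer : layer R :=
  sparse_layer 1 n.+1 (fun i => ([:: (0%N, 1)], - c i)).

Definition column_layer : layer R :=
  sparse_layer n.+1 n (fun k =>
    ([:: (k, (c k.+1 - c k)^-1); (k.+1, - (c k.+1 - c k)^-1)], 0)).

(** Turns each ramp value into the arguments of the two hinges, at 0 and 1/2, from which [tent] is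
    formed. The last row averages the ramps, which already is the first output coordinate. *)
Definition split_layer : layer R :=
  sparse_layer n (n + n).+1 (fun i =>
    if (i < n)%N then ([:: (i, 1)], 0)
    else if (i < n + n)%N then ([:: ((i - n)%N, 1)], - 2^-1)
    else ([seq (k, n%:R^-1) | k <- iota 0 n], 0)).

(** Assembles the tent of every column from its two hinges and at once splits the result into the
    next two; the last row carries the first output coordinate. *)
Definition tent_layer : layer R :=
  sparse_layer (n + n).+1 (n + n).+1 (fun i =>
    if (i < n)%N then ([:: (i, 2); ((n + i)%N, -4)], 0)
    else if (i < n + n)%N then ([:: ((i - n)%N, 2); (i, -4)], - 2^-1)
    else ([:: ((n + n)%N, 1)], 0)).

(** Row [k * n.+1 + l] applies one more tent in column [k] and subtracts the knot [d k l]; quotient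
    and remainder by [n.+1] recover [k] and [l], since a column has [n.+1] knots. *)
Definition cell_layer : layer R :=
  sparse_layer (n + n).+1 (n * n.+1).+1 (fun i =>
    if (i < n * n.+1)%N then
      ([:: ((i %/ n.+1)%N, 2); ((n + i %/ n.+1)%N, -4)], - d (i %/ n.+1) (i %% n.+1))
    else ([:: ((n + n)%N, 1)], 0)).

(** Slope of the [l]-th ramp of column [k], with the final division by [n] absorbed. *)
Definition cell_weight k l : R := (d k l.+1 - d k l)^-1 / n%:R.

Definition output_layer : layer R :=
  sparse_layer (n * n.+1).+1 2 (fun i =>
    if i == 0%N then ([:: ((n * n.+1)%N, 1)], 0)
    else ([seq ((k * n.+1 + l)%N, cell_weight k l) | k <- iota 0 n, l <- iota 0 n]
       ++ [seq ((k * n.+1 + l.+1)%N, - cell_weight k l) | k <- iota 0 n, l <- iota 0 n], 0)).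

(** The [s] tent layers together with the tent inside [cell_layer] give [s.+1] iterations, hence a
    sawtooth with [2 ^ s.+1] branches. *)
Definition network (s : nat) : seq (layer R) :=
  [:: hinge_layer; column_layer; split_layer] ++ nseq s tent_layer
    ++ [:: cell_layer; output_layer].

(* The hidden state carrying, for every column [k], the two hinges from which
   [tent (h k)] is assembled, followed by the first output coordinate. *)
Definition net_state h x : seq R :=
  mkseq (fun i => if (i < n)%N then relu (h i)
                  else if (i < n + n)%N then relu (h (i - n)%N - 2^-1) else x)
    (n + n).+1.

Lemma nth_state_l h x k : (k < n)%N -> nth 0 (net_state h x) k = relu (h k).
Proof. by move=> kn; rewrite nth_mkseq ?kn // ltnS (leq_trans (ltnW kn)) ?leq_addr. Qed.

Lemma nth_state_r h x k : (k < n)%N ->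
  nth 0 (net_state h x) (n + k) = relu (h k - 2^-1).
Proof.
move=> kn; rewrite nth_mkseq; last by rewrite ltnS leq_add2l ltnW.
by rewrite ltnNge leq_addr /= ltn_add2l kn addKn.
Qed.

Lemma nth_state_x h x : nth 0 (net_state h x) (n + n) = x.
Proof. by rewrite nth_mkseq // ltnNge leq_addr /= ltnn. Qed.

Lemma state_tent h x k : (k < n)%N ->
  2 * nth 0 (net_state h x) k + (-4) * nth 0 (net_state h x) (n + k) = tent (h k).
Proof. by move=> kn; rewrite nth_state_l // nth_state_r // /tent mulNr. Qed.

(** Nonnegativity of [x] lets the carried coordinate pass through the ReLU unchanged. *)
Lemma apply_tent_layer h x : 0 <= x ->
  map (@relu R) (apply_layer tent_layer (net_state h x)) = net_state (@tent R \o h) x.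
Proof.
move=> x0; rewrite apply_sparse_layer ?size_mkseq // /net_state -[LHS]map_comp.
apply/eq_in_map => i; rewrite mem_iota /= add0n ltnS => i2n.
rewrite /row_eval; case: ifPn => [iln|]; first by
  rewrite /= !big_cons big_nil /= !addr0 state_tent.
rewrite -leqNgt => ni; case: ifPn => [i2n'|]; last first.
  by rewrite /= !big_cons big_nil /= !addr0 mul1r nth_state_x relu_id.
rewrite /= !big_cons big_nil /= addr0; congr (relu (_ - _)).
by rewrite -{2}(subnKC ni) state_tent // ltn_subLR.
Qed.

Definition net_out h x : seq R :=
  [:: x; \sum_(k < n) staircase (d k) n (tent (h k)) / n%:R].

Lemma realize_tail h x : 0 <= x ->
  realize [:: cell_layer; output_layer] (net_state h x) = net_out h x.
Proof.
move=> x0 /=; rewrite [apply_layer cell_layer _]apply_sparse_layer ?size_mkseq //.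
set v := map _ _.
have vE k l : (k < n)%N -> (l <= n)%N ->
    nth 0 v (k * n.+1 + l) = relu (tent (h k) - d k l).
  move=> kn ln; have lt : (k * n.+1 + l < n * n.+1)%N.
    by rewrite (leq_trans _ (_ : k.+1 * n.+1 <= _)%N) ?leq_mul2r // mulSn addnC ltn_add2r.
  rewrite /v (nth_map 0) ?size_mkseq ?ltnS ?(ltnW lt) //.
  rewrite nth_mkseq ?ltnS ?(ltnW lt) // lt /row_eval /= !big_cons big_nil /= addr0.
  by rewrite divnMDl // divn_small // addn0 modnMDl modn_small // state_tent.
have vx : nth 0 v (n * n.+1) = x.
  rewrite /v (nth_map 0) ?size_mkseq // nth_mkseq // ltnn /row_eval /=.
  by rewrite !big_cons big_nil /= !addr0 mul1r nth_state_x relu_id.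
have sz_v : size v = (n * n.+1).+1 by rewrite /v size_map size_mkseq.
rewrite apply_sparse_layer ?sz_v // /mkseq /= /net_out.
rewrite /row_eval /= !big_cons big_nil !addr0 /= mul1r vx; congr [:: _; _].
rewrite big_cat !big_allpairs_dep /=.
rewrite -big_split /= sum_iota.
apply: eq_bigr => k _; rewrite -big_split /= /staircase mulr_suml.
rewrite sum_iota.
apply: eq_bigr => l _ /=.
by rewrite vE // ?vE // ?(ltnW (ltn_ord l)) // /cell_weight /clip; ring.
Qed.

Lemma realize_tents s h x : 0 <= x ->
  realize (nseq s tent_layer ++ [:: cell_layer; output_layer]) (net_state h x)
  = net_out (fun k => iter s (@tent R) (h k)) x.
Proof.
elim: s h => [|s IH] h x0; first exact: realize_tail.
rewrite [nseq _ _]/= cat_cons realize_cons ?size_cat ?addn2 //.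
rewrite apply_tent_layer // IH //; congr net_out.
by apply/funext => k; rewrite /= -iterSr.
Qed.

Definition net1 u : R := staircase c n u / n%:R.

Definition net2 s u : R :=
  \sum_(k < n) staircase (d k) n (iter s (@tent R) (clip (c k) (c k.+1) u)) / n%:R.

Lemma realize_network s u : realize12 (network s) u = (net1 u, net2 s.+1 u).
Proof.
rewrite /realize12 /network !cat_cons cat0s !realize_cons ?size_cat ?addn2 //.
rewrite [apply_layer hinge_layer _]apply_sparse_layer //.
set v := map _ (mkseq _ _).
have vE i : (i <= n)%N -> nth 0 v i = relu (u - c i).
  move=> ilen; rewrite /v (nth_map 0) ?size_mkseq // nth_mkseq // /row_eval /=.
  by rewrite big_cons big_nil /= addr0 mul1r.
have sz_v : size v = n.+1 by rewrite /v size_map size_mkseq.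
rewrite [apply_layer column_layer _]apply_sparse_layer ?sz_v //; clearbody v.
set z := map _ (mkseq _ _).
have zE k : (k < n)%N -> nth 0 z k = clip (c k) (c k.+1) u.
  move=> kn; rewrite /z (nth_map 0) ?size_mkseq // nth_mkseq // /row_eval /=.
  rewrite !big_cons big_nil /= !addr0 !vE // ?(ltnW kn) // mulNr -mulrBr mulrC.
  by rewrite relu_id ?clip_ge0 // -/(clip _ _ u) clip_ge0.
rewrite [apply_layer split_layer _]apply_sparse_layer ?size_map ?size_iota //.
have net1_ge0 : 0 <= net1 u by rewrite divr_ge0 ?staircase_ge0.
rewrite (_ : map _ _ = net_state (fun k => clip (c k) (c k.+1) u) (net1 u)).
  by rewrite realize_tents.
rewrite /net_state -[LHS]map_comp; apply/eq_in_map => i.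
rewrite mem_iota /= add0n ltnS => i2n; rewrite /row_eval.
case: ifPn => [iln|]; first by rewrite /= big_cons big_nil /= !addr0 mul1r zE.
rewrite -leqNgt => ni; case: ifPn => [i2n'|_]; last first.
  rewrite /= addr0 big_map -[RHS]relu_id //; congr relu.
  rewrite sum_iota /net1 /staircase mulr_suml.
  by apply: eq_bigr => k _ /=; rewrite zE // mulrC.
by rewrite /= big_cons big_nil /= !addr0 mul1r zE // ltn_subLR.
Qed.

Lemma is_net_network s : is_net 1 2 (network s).
Proof.
split; first by rewrite /network !size_cat size_nseq /=; lia.
apply: (@dims_ok_cat _ _ (n + n).+1); first by rewrite /= !eqxx.
apply: (@dims_ok_cat _ _ (n + n).+1); last by rewrite /= !eqxx.
by elim: s => //= s ->; rewrite eqxx.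
Qed.

Lemma depth_network s : depth (network s) = (s + 5)%N.
Proof. by rewrite /depth /network !size_cat size_nseq /=; lia. Qed.

(** The layer bounds add up to [5 n^2 + 13 n + 9 + s (6 n + 3)], which for [n >= 1] is at most
    [27 n^2 + 9 n s]. *)
Lemma connectivity_network s : (connectivity (network s) < 88 * (n ^ 2 + n * s))%N.
Proof.
rewrite /connectivity /network !big_cat big_nseq /= !big_cons !big_nil !addn0.
have H1 : (layer_nnz hinge_layer <= n.+1 * 2)%N.
  exact: layer_nnz_sparse_le.
have H2 : (layer_nnz column_layer <= n * 3)%N.
  exact: layer_nnz_sparse_le.
have H3 : (layer_nnz split_layer <= (n + n) * 2 + n.+1)%N.
  apply: leq_trans (layer_nnz_sparse _ _ _) _; rewrite big_ord_recr /= ltnNge leq_addr ltnn /=.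
  rewrite size_map size_iota leq_add2r.
  rewrite -[X in (X * 2)%N]card_ord -sum_nat_const; apply: leq_sum => i _.
  by rewrite ltn_ord; case: ifP.
have H4 : (layer_nnz tent_layer <= (n + n).+1 * 3)%N.
  apply: layer_nnz_sparse_le => i _.
  by do 2 case: ifP => //.
have H5 : (layer_nnz cell_layer <= (n * n.+1).+1 * 3)%N.
  apply: layer_nnz_sparse_le => i _.
  by case: ifP.
have H6 : (layer_nnz output_layer <= 2 + (n * n + n * n).+1)%N.
  apply: leq_trans (layer_nnz_sparse _ _ _) _; rewrite !big_ord_recr big_ord0 /=.
  by rewrite size_cat !size_allpairs size_iota.
have H7 : (iter s (addn (layer_nnz tent_layer)) 0 <= s * ((n + n).+1 * 3))%N.
  by elim: s => //= s IH; rewrite mulSn leq_add.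
rewrite -mulnn; nia.
Qed.

End Network.

(** * Lebesgue integrals under affine substitutions and partitions *)

Section AffineSubstitution.
Context {R : realType}.
Local Open Scope ereal_scope.
Notation mu := (@lebesgue_measure R).
Implicit Types (a b : R) (f : R -> \bar R).

Lemma measurable_affine a b :
  measurable_fun setT (fun t : R => (a + b * t)%R : measurableTypeR R).
Proof. by apply: measurable_funD => //; exact: measurable_funM. Qed.

(** By uniqueness of Lebesgue measure it is enough to compare lengths of half-open intervals. A
    negative [b] moves the closed end to the other side, which leaves the length unchanged. *)
Lemma lebesgue_measure_affine a b (A : set R) : b != 0%R -> measurable A ->
  mu A = `|b|%:E * mu ((fun t => a + b * t)%R @^-1` A).
Proof.
move=> b0 mA.
pose phi : measurableTypeR R -> measurableTypeR R := fun t => (a + b * t)%R.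
have mphi : measurable_fun setT phi by exact: measurable_affine.
pose nu : {measure set _ -> \bar R} :=
  mscale (NngNum (normr_ge0 b)) (pushforward mu phi : {measure set _ -> \bar R}).
rewrite (@lebesgue_measure_unique _ (nu mphi)) // => _ [[x y]] _ <-.
rewrite /nu /= /mscale /= /pushforward lebesgue_measure_itv /= lte_fin.
have [b_gt0|b_lt0|b_eq0] := ltgtP 0%R b; last by rewrite -b_eq0 eqxx in b0.
- rewrite (_ : phi @^-1` _ = `]((x - a) / b)%R, ((y - a) / b)%R]%classic); last first.
    apply/seteqP; split => t /=; rewrite /phi !in_itv /= ltr_pdivrMr // ler_pdivlMr //;
    by move=> /andP[? ?]; apply/andP; split; lra.
  rewrite lebesgue_measure_itv /= lte_fin ltr_pM2r ?invr_gt0 // ltrD2r.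
  case: ifP => _; last by rewrite mule0.
  by rewrite -!EFinB -EFinM gtr0_norm //; congr (_%:E); field; rewrite gt_eqF.
- rewrite (_ : phi @^-1` _ = `[((y - a) / b)%R, ((x - a) / b)%R[%classic); last first.
    apply/seteqP; split => t /=; rewrite /phi !in_itv /= ler_ndivrMr // ltr_ndivlMr //;
    by move=> /andP[? ?]; apply/andP; split; lra.
  rewrite lebesgue_measure_itv /= lte_fin ltr_nM2r ?invr_lt0 // ltrD2r.
  case: ifP => _; last by rewrite mule0.
  by rewrite -!EFinB -EFinM ltr0_norm //; congr (_%:E); field; rewrite lt_eqF.
Qed.

Lemma ge0_integral_affine a b (D : set R) f : b != 0%R -> measurable D ->
  measurable_fun setT f -> (forall x, 0 <= f x) ->
  \int[mu]_(x in D) f x =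
  `|b|%:E * \int[mu]_(t in (fun t => a + b * t)%R @^-1` D) f (a + b * t)%R.
Proof.
move=> b0 mD mf f0.
pose phi : measurableTypeR R -> measurableTypeR R := fun t => (a + b * t)%R.
have mphi : measurable_fun setT phi by exact: measurable_affine.
pose nu : {measure set _ -> \bar R} := pushforward mu phi.
rewrite (eq_measure_integral (mscale (NngNum (normr_ge0 b)) (nu mphi))); last first.
  by move=> A mA _; exact: lebesgue_measure_affine.
rewrite ge0_integral_mscale //=; last exact: measurable_funTS.
by rewrite ge0_integral_pushforward //; exact: measurable_funTS.
Qed.

Lemma ge0_integral_itv_affine a b f : (a < b)%R ->
  measurable_fun setT f -> (forall x, 0 <= f x) ->
  \int[mu]_(x in `]a, b[) f x =
  (b - a)%:E * \int[mu]_(t in `]0%R, 1%R[) f (a + (b - a) * t)%R.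
Proof.
move=> ab mf f0; have ba : (0 < b - a)%R by rewrite subr_gt0.
rewrite (@ge0_integral_affine a (b - a)%R) ?gt_eqF // gtr0_norm //.
congr (_ * integral _ _ _); apply/seteqP; split => t /=; rewrite !in_itv /=;
  by move=> /andP[? ?]; apply/andP; split; nra.
Qed.

Lemma ge0_integral_onem f :
  measurable_fun setT f -> (forall x, 0 <= f x) ->
  \int[mu]_(t in `]0%R, 1%R[) f (1 - t)%R = \int[mu]_(t in `]0%R, 1%R[) f t.
Proof.
move=> mf f0; rewrite [RHS](@ge0_integral_affine 1 (-1)) ?oppr_eq0 ?oner_eq0 //.
rewrite normrN1 mul1e (_ : _ @^-1` _ = `]0%R, 1%R[%classic).
  by apply: eq_integral => t _; rewrite mulN1r.
apply/seteqP; split => t /=; rewrite !in_itv /=;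
  by move=> /andP[? ?]; apply/andP; split; lra.
Qed.

Lemma measurable_comp_affine a b f : measurable_fun setT f ->
  measurable_fun setT (fun t : R => f (a + b * t)%R).
Proof. by move=> mf; exact: (measurableT_comp mf (measurable_affine a b)). Qed.

(** The open pieces omit only the interior knots, which are null sets. *)
Lemma ge0_integral_partition (c : nat -> R) (n : nat) f :
  (forall k, c k < c k.+1)%R -> measurable_fun setT f -> (forall x, 0 <= f x) ->
  \int[mu]_(x in `]c 0%N, c n[) f x =
  \sum_(k < n) \int[mu]_(x in `]c k, c k.+1[) f x.
Proof.
move=> cS mf f0; elim: n => [|n IH].
  by rewrite big_ord0 set_itv_ge ?integral_set0 // bnd_simp ltxx.
have c0n : (c 0%N <= c n)%R by exact: strict_incr_le.
rewrite big_ord_recr /= -IH.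
have [c0n'|] := ltP (c 0%N) (c n); last first.
  move=> cn0; have -> : c 0%N = c n by apply/eqP; rewrite eq_le c0n.
  by rewrite [X in integral _ X _ + _]set_itv_ge ?integral_set0 ?add0e // bnd_simp ltxx.
rewrite (@itv_bndbnd_setU _ _ _ (BLeft (c n))) ?bnd_simp ?(ltW (cS n)) //.
rewrite ge0_integral_setU //=.
- congr (_ + _); rewrite integral_itv_bndoo //; exact: measurable_funTS.
- exact: measurable_funTS.
- rewrite disj_set2E; apply/eqP/seteqP; split => // t /=.
  rewrite !in_itv /= => -[] /andP[_ h] /andP[h' _].
  by move: (lt_le_trans h h'); rewrite ltxx.
Qed.

Lemma ge0_integral_staircase (c : nat -> R) (n : nat) f :
  (forall k, c k < c k.+1)%R -> c 0%N = 0%R -> c n = 1%R ->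
  measurable_fun setT f -> (forall x, 0 <= f x) ->
  \int[mu]_(x in `]0%R, 1%R[) f x =
  \sum_(k < n) (c k.+1 - c k)%:E *
    \int[mu]_(t in `]0%R, 1%R[) f (c k + (c k.+1 - c k) * t)%R.
Proof.
move=> cS c0 cn mf f0; rewrite -{1}c0 -{1}cn ge0_integral_partition //.
by apply: eq_bigr => k _; exact: ge0_integral_itv_affine.
Qed.

Lemma ge0_integral_equipartition (m : nat) f : (0 < m)%N ->
  measurable_fun setT f -> (forall x, 0 <= f x) ->
  \int[mu]_(x in `]0%R, 1%R[) f x =
  \sum_(j < m) (m%:R^-1)%:E *
    \int[mu]_(t in `]0%R, 1%R[) f ((j%:R + t) / m%:R)%R.
Proof.
move=> m0 mf f0; have m0' : (0 < m%:R :> R)%R by rewrite ltr0n.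
rewrite (@ge0_integral_staircase (fun j => j%:R / m%:R)%R m) //; last 3 first.
- by move=> k; rewrite ltr_pM2r ?invr_gt0 // ltr_nat.
- by rewrite mul0r.
- by rewrite divff // gt_eqF.
have E k : (k.+1%:R / m%:R - k%:R / m%:R = m%:R^-1 :> R)%R.
  by rewrite -mulrBl -natr1 addrAC subrr add0r mul1r.
apply: eq_bigr => k _; rewrite E; congr (_ * _).
by apply: eq_integral => t _; congr (f _); ring.
Qed.

End AffineSubstitution.

(** * The coupling that resamples the first coordinate within its strip *)

Definition mfun_of d1 d2 (T1 : measurableType d1) (T2 : measurableType d2)
    (f : T1 -> T2) (mf : measurable_fun setT f) : {mfun T1 >-> T2} :=
  HB.pack f (isMeasurableFun.Build _ _ _ _ f mf).

Section StripCoupling.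
Context {R : realType}.
Local Open Scope ereal_scope.
Notation mu := (@lebesgue_measure R).
Notation unif := (uniform_prob (@ltr01 R)).

Lemma ge0_integral_uniform (f : R -> \bar R) :
  measurable_fun setT f -> (forall x, 0 <= f x) ->
  \int[unif]_x f x = \int[mu]_(x in `]0%R, 1%R[) f x.
Proof.
move=> mf f0; rewrite integral_uniform // subr0 invr1 mul1e.
by rewrite integral_itv_bndoo //; exact: measurable_funTS.
Qed.

(** Writing the integral over the unit interval as a full integral against the uniform law makes it
    a section integral in the sense of Tonelli. *)
Lemma measurable_fun_integral01 (f : R * R -> \bar R) :
  measurable_fun setT f -> (forall z, 0 <= f z) ->
  measurable_fun [set: R] (fun x => \int[mu]_(y in `]0%R, 1%R[) f (x, y)).
Proof.
move=> mf f0; rewrite (_ : (fun x => _) = fubini_F unif f).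
  exact: measurable_fun_fubini_tonelli_F.
apply/funext => x; rewrite /fubini_F ge0_integral_uniform //.
exact: measurableT_comp.
Qed.

Lemma ge0_integral_uniform2 (f : R * R -> \bar R) :
  measurable_fun setT f -> (forall z, 0 <= f z) ->
  \int[(unif \x unif)]_z f z =
  \int[mu]_(x in `]0%R, 1%R[) \int[mu]_(y in `]0%R, 1%R[) f (x, y).
Proof.
move=> mf f0; rewrite fubini_tonelli1 // ge0_integral_uniform.
- apply: eq_integral => x _; rewrite /fubini_F ge0_integral_uniform //.
  exact: measurableT_comp.
- exact: measurable_fun_fubini_tonelli_F.
- by move=> x; exact: integral_ge0.
Qed.

Lemma measurable_eucl_dist : measurable_fun setT (@eucl_dist R).
Proof.
apply: (measurableT_comp (continuous_measurable_fun (@sqrt_continuous R))).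
by apply: measurable_funD; apply: measurable_funX; apply: measurable_funB;
  apply: measurableT_comp => //; apply: measurableT_comp.
Qed.

Variables (X Y : R -> R) (N : nat).
Hypotheses (mX : measurable_fun setT X) (mY : measurable_fun setT Y).
Hypotheses (X_ge0 : forall u, (0 <= X u)%R) (N_gt0 : (0 < N)%N).

(* The second point is moved horizontally, uniformly inside the vertical strip
   of width [1 / N] which contains the first one. *)
Definition strip_point (z : R * R) : R * R :=
  (((Num.truncn (N%:R * X z.1))%:R + z.2) / N%:R, Y z.1)%R.

Definition strip_pair (z : R * R) : (R * R) * (R * R) :=
  ((X z.1, Y z.1), strip_point z).

Lemma measurable_strip_point : measurable_fun setT strip_point.
Proof.
apply/measurable_fun_pairP; split; last exact: (measurableT_comp mY measurable_fst).
apply: measurable_funM => //; apply: measurable_funD => //.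
have mtrunc : measurable_fun [set: R] (fun t => (Num.truncn t)%:R : R).
  by apply: nondecreasing_measurable => // x y xy; rewrite ler_nat le_truncn.
apply: (measurableT_comp mtrunc); apply: measurable_funM => //.
exact: (measurableT_comp mX measurable_fst).
Qed.

Lemma measurable_strip_pair : measurable_fun setT strip_pair.
Proof.
apply/measurable_fun_pairP; split; last exact: measurable_strip_point.
apply/measurable_fun_pairP; split.
  exact: (measurableT_comp mX measurable_fst).
exact: (measurableT_comp mY measurable_fst).
Qed.

(** The two points have the same second coordinate, and their first coordinates lie in the same
    strip of width [1 / N]. *)
Lemma eucl_dist_strip_pair u v : (0 < v < 1)%R ->
  (eucl_dist (strip_pair (u, v)) <= N%:R^-1)%R.
Proof.
move=> /andP[v0 v1]; rewrite /eucl_dist /= subrr expr0n addr0 sqrtr_sqr.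
have NR : (0 < N%:R :> R)%R by rewrite ltr0n.
have := truncn_itv (mulr_ge0 (ltW NR) (X_ge0 u)).
set k := (Num.truncn _)%:R; rewrite -natr1 -/k => /andP[h1 h2].
have -> : (X u - (k + v) / N%:R = (N%:R * X u - k - v) / N%:R)%R.
  by field; rewrite gt_eqF.
rewrite normrM [X in (_ * X)%R]gtr0_norm ?invr_gt0 // ler_piMl ?invr_ge0 ?ltW //.
by rewrite ltr_norml; apply/andP; split; lra.
Qed.

(** The coupling is the law of [strip_pair] under two independent uniform variables. Its first
    marginal is the law of [(X, Y)] because the first point ignores the resampling variable; its
    second marginal is [nu] by hypothesis. The cost is below [1 / N] pointwise. *)
Lemma wasserstein1_strip (nu : set (R * R) -> \bar R) :
  (forall B, measurable B ->
    \int[mu]_(u in `]0%R, 1%R[) \int[mu]_(v in `]0%R, 1%R[)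
      (\1_B (strip_point (u, v)))%:E = nu B) ->
  wasserstein1 (pushforward (@unif01 R) (fun u => (X u, Y u))) nu <= (N%:R^-1)%:E.
Proof.
move=> nuE.
have mT : measurable_fun [set: (measurableTypeR R * measurableTypeR R)%type] strip_pair.
  exact: measurable_strip_pair.
pose P : probability ((R * R) * (R * R))%type R :=
  distribution (unif \x unif) (mfun_of mT).
have PE A : P A = (unif \x unif) (strip_pair @^-1` A) by [].
have mXY : measurable_fun setT (fun u => (X u, Y u)).
  by apply/measurable_fun_pairP; split.
have P_coupling : is_coupling (pushforward (@unif01 R) (fun u => (X u, Y u))) nu P.
  split=> [A mA|B mB]; rewrite PE.
  - rewrite (_ : _ @^-1` _ = ((fun u => (X u, Y u)) @^-1` A) `*` setT); last first.
      by apply/seteqP; split => z /=; tauto.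
    have mA' : measurable ((fun u => (X u, Y u)) @^-1` A).
      by rewrite -[X in measurable X]setTI; exact: mXY.
    have -> : (unif \x unif) (((fun u => (X u, Y u)) @^-1` A) `*` setT) =
        unif ((fun u => (X u, Y u)) @^-1` A).
      rewrite product_measure1E // -[RHS]mule1; congr (_ * _).
      exact: (@probability_setT _ _ _ unif).
    rewrite /pushforward /unif01 -[in LHS](setIT (_ @^-1` _)) -integral_indic //.
    rewrite integral_uniform //; last first.
      by apply/measurable_EFinP; exact: measurable_indic.
    by rewrite subr0 invr1 mul1e integral_indic.
  - rewrite (_ : _ @^-1` _ = strip_point @^-1` B); last first.
      by apply/seteqP; split => z //= [].
    rewrite -nuE // -[in LHS](setIT (_ @^-1` _)).
    have mB' : measurable (strip_point @^-1` B).
      by rewrite -[X in measurable X]setTI; exact: measurable_strip_point.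
    rewrite -integral_indic // ge0_integral_uniform2 //.
    by apply/measurable_EFinP; exact: measurable_indic.
have mcost : measurable_fun setT (fun z => (eucl_dist (strip_pair z))%:E).
  apply/measurable_EFinP; apply: (measurableT_comp measurable_eucl_dist).
  exact: measurable_strip_pair.
have cost_ge0 z : 0 <= (eucl_dist (strip_pair z))%:E.
  by rewrite lee_fin sqrtr_ge0.
apply: le_trans (_ : \int[P]_z (eucl_dist z)%:E <= _).
  by apply: ereal_inf_lbound; exists P.
rewrite ge0_integral_distribution //; last first.
- by move=> z; rewrite lee_fin sqrtr_ge0.
- by apply/measurable_EFinP; exact: measurable_eucl_dist.
rewrite ge0_integral_uniform2 //.
have cstE : \int[mu]_(x in `]0%R, 1%R[) (N%:R^-1)%:E = (N%:R^-1)%:E.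
  by rewrite integral_cst //= lebesgue_measure_itv /= lte_fin ltr01 sube0 mule1.
rewrite -[leRHS]cstE; apply: ge0_le_integral => //.
- by move=> u _; apply: integral_ge0 => v _; rewrite lee_fin sqrtr_ge0.
- by apply: measurable_funTS; exact: (measurable_fun_integral01 mcost cost_ge0).
move=> u _; rewrite -[leRHS]cstE; apply: ge0_le_integral => //.
- by move=> v _; rewrite lee_fin sqrtr_ge0.
- apply: measurable_funTS; exact: (measurableT_comp mcost).
- by move=> v /=; rewrite in_itv /= => v01; rewrite lee_fin eucl_dist_strip_pair.
Qed.

End StripCoupling.

(** * Values of the network on each column, sawtooth branch and cell *)

Section Cells.
Context {R : realType}.
Variables (n m : nat) (c : nat -> R) (d : nat -> nat -> R).
Hypotheses (m_gt0 : (0 < m)%N) (cS : forall k, c k < c k.+1).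
Hypotheses (c0 : c 0 = 0) (cn : c n = 1).
Hypotheses (dS : forall k l, d k l < d k l.+1).
Hypotheses (d0 : forall k, d k 0 = 0) (dn : forall k, d k n = 1).
Notation mu := (@lebesgue_measure R).

(** The sawtooth value at which [staircase (d k) n] equals [l + t]. *)
Definition cell_height k l t : R := d k l + (d k l.+1 - d k l) * t.

(* On odd branches the sawtooth decreases, hence the reflection. *)
Definition branch_pos k j l t : R :=
  (j%:R + (if odd j then 1 - cell_height k l t else cell_height k l t)) / 2 ^+ m.

(** The input in column [k], on branch [j] of its sawtooth, whose second output coordinate is
    [(l + t) / n]. *)
Definition cell_point k j l t : R := c k + (c k.+1 - c k) * branch_pos k j l t.

Lemma cell_height_itv k l t : (l < n)%N -> 0 < t < 1 -> 0 < cell_height k l t < 1.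
Proof.
move=> ln /andP[t0 t1]; have dkl := dS k l.
have h0 : 0 <= d k l by rewrite -(d0 k) strict_incr_le.
have h1 : d k l.+1 <= 1 by rewrite -(dn k) strict_incr_le.
by rewrite /cell_height; apply/andP; split; nra.
Qed.

Lemma branch_posE k j l t : (l < n)%N -> 0 < t < 1 ->
  exists2 r, 0 < r < 1 & branch_pos k j l t = (j%:R + r) / 2 ^+ m.
Proof.
move=> ln /(cell_height_itv k ln)/andP[h0 h1].
exists (if odd j then 1 - cell_height k l t else cell_height k l t) => //.
by case: (odd j); apply/andP; split; lra.
Qed.

Lemma branch_pos_itv k j l t : (j < 2 ^ m)%N -> (l < n)%N -> 0 < t < 1 ->
  0 <= branch_pos k j l t <= 1.
Proof.
move=> jm ln /(branch_posE k j ln)[r /andP[r0 r1] ->].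
have M0 : 0 < 2 ^+ m :> R by rewrite exprn_gt0.
have : (j.+1%:R : R) <= 2 ^+ m by rewrite -natrX ler_nat.
rewrite -natr1 => jM; have j0 : 0 <= j%:R :> R by [].
by rewrite divr_ge0 ?(ltW M0) //=; [rewrite ler_pdivrMr //; lra | lra].
Qed.

Lemma net1_cell_point k j l t : (k < n)%N -> (j < 2 ^ m)%N -> (l < n)%N ->
  0 < t < 1 -> net1 n c (cell_point k j l t) = (k%:R + branch_pos k j l t) / n%:R.
Proof.
by move=> kn jm ln t01; rewrite /net1 staircase_mid // branch_pos_itv.
Qed.

(** Only column [k] contributes. There the reflection built into [branch_pos] cancels that of the
    sawtooth, which leaves [cell_height k l t]. *)
Lemma net2_cell_point k j l t : (k < n)%N -> (j < 2 ^ m)%N -> (l < n)%N ->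
  0 < t < 1 -> net2 n c d m (cell_point k j l t) = (l%:R + t) / n%:R.
Proof.
move=> kn jm ln t01; have b01 := branch_pos_itv k jm ln t01.
have /andP[h0 h1] := cell_height_itv k ln t01.
rewrite /net2 (bigD1 (Ordinal kn)) //= clip_mid // big1 ?addr0; last first.
  move=> i ik; rewrite clip_mid_neq //.
  rewrite (_ : iter m _ _ = 0); first by rewrite staircase_start ?d0 ?mul0r.
  (* A column already passed feeds 1 into its sawtooth; the first tent sends it to 0, which is where
     [0 < m] enters. *)
  case: (i < k)%N; last exact: iter_tent0.
  by rewrite -(prednK m_gt0) iterSr tent1 iter_tent0.
congr (_ / _); rewrite iter_tentE //; last by case: ifP => _; apply/andP; split; lra.
rewrite (_ : (if odd j then _ else _) = cell_height k l t); last first.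
  by case: (odd j) => //; rewrite opprB addrC subrK.
by move: t01 => /andP[t0 t1]; rewrite staircase_mid // (ltW t0) ltW.
Qed.

(** Three nested partitions: the columns by [c], the equal branches of the sawtooth, then the
    heights by [d k]. The Jacobian factors multiply to the weight. *)
Lemma ge0_integral_cells (G : R -> \bar R) : measurable_fun [set: R] G ->
  (forall x, 0 <= G x)%E ->
  (\int[mu]_(u in `]0%R, 1%R[) G u =
   \sum_(k < n) \sum_(j < 2 ^ m) \sum_(l < n)
     ((c k.+1 - c k) / 2 ^+ m * (d k l.+1 - d k l))%:E *
       \int[mu]_(t in `]0%R, 1%R[) G (cell_point k j l t))%E.
Proof.
move=> mG G0; rewrite (@ge0_integral_staircase _ c n) //; apply: eq_bigr => k _.
pose Gk (x : R) := G (c k + (c k.+1 - c k) * x).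
have mGk : measurable_fun [set: R] Gk by exact: measurable_comp_affine.
have Gk0 x : (0 <= Gk x)%E by exact: G0.
have ck0 : 0 <= c k.+1 - c k by rewrite subr_ge0 ltW.
have M0 : 0 < 2 ^+ m :> R by rewrite exprn_gt0.
rewrite (@ge0_integral_equipartition _ (2 ^ m) Gk) ?expn_gt0 //.
rewrite ge0_sume_distrr; last first.
  move=> j _; rewrite mule_ge0 ?lee_fin ?invr_ge0 //.
  by apply: integral_ge0 => x _; exact: G0.
apply: eq_bigr => j _.
pose Gj (x : R) := Gk ((j%:R + x) / (2 ^ m)%:R).
have mGj : measurable_fun [set: R] Gj.
  rewrite /Gj (_ : (fun x => _) = fun x => Gk (j%:R / (2 ^ m)%:R + (2 ^ m)%:R^-1 * x)).
    exact: measurable_comp_affine.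
  by apply/funext => x; congr Gk; ring.
have Gj0 x : (0 <= Gj x)%E by exact: G0.
(* Reflecting the odd branches preserves the integral and turns position on a branch into sawtooth
   height. *)
pose Gh (x : R) := Gj (if odd j then 1 - x else x).
have mGh : measurable_fun [set: R] Gh.
  rewrite /Gh; case: (odd j) => //.
  rewrite (_ : (fun x => _) = fun x => Gj (1 + (-1) * x)); first exact: measurable_comp_affine.
  by apply/funext => x; rewrite mulN1r.
have Gh0 x : (0 <= Gh x)%E by exact: G0.
have -> : (\int[mu]_(x in `]0%R, 1%R[) Gj x = \int[mu]_(x in `]0%R, 1%R[) Gh x)%E.
  by rewrite /Gh; case: (odd j) => //;     rewrite ge0_integral_onem.
rewrite (@ge0_integral_staircase _ (d k) n) // muleA -EFinM ge0_sume_distrr; last first.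
  move=> l _; rewrite mule_ge0 ?lee_fin ?subr_ge0 ?(ltW (dS _ _)) //.
  by apply: integral_ge0 => x _; exact: G0.
apply: eq_bigr => l _; rewrite muleA -EFinM natrX; congr (_ * _)%E.
apply: eq_integral => t _; rewrite /Gh /Gj /Gk /cell_point /branch_pos natrX.
by [].
Qed.

(** The scaled first coordinate is [k * 2 ^ m + j + r] with [0 < r < 1], so truncation identifies
    column and branch and discards the dependence on [t]. *)
Lemma strip_cell_point k j l t v : (0 < n)%N ->
  (k < n)%N -> (j < 2 ^ m)%N -> (l < n)%N -> 0 < t < 1 ->
  strip_point (net1 n c) (net2 n c d m) (n * 2 ^ m) (cell_point k j l t, v) =
  ((k%:R + (j%:R + v) / 2 ^+ m) / n%:R, (l%:R + t) / n%:R).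
Proof.
move=> n0 kn jm ln t01; rewrite /strip_point /= net1_cell_point // net2_cell_point //.
have [r /andP[r0 r1] ->] := branch_posE k j ln t01.
have M0 : 2 ^+ m != 0 :> R by rewrite gt_eqF // exprn_gt0.
have n0' : n%:R != 0 :> R by rewrite pnatr_eq0 -lt0n.
have -> : (n * 2 ^ m)%:R * ((k%:R + (j%:R + r) / 2 ^+ m) / n%:R) = (k * 2 ^ m + j)%:R + r :> R.
  by rewrite natrM natrX natrD natrM natrX; field; rewrite M0 n0'.
rewrite (@truncn_def _ _ (k * 2 ^ m + j)); last by rewrite -natr1; apply/andP; split; lra.
by congr (_, _); rewrite natrM natrX natrD natrM natrX; field; rewrite M0 n0'.
Qed.

End Cells.

(** * Measurability of the network coordinates *)

Section NetworkMeasurable.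
Context {R : realType}.

Lemma measurable_relu : measurable_fun [set: R] (@relu R).
Proof. by apply: measurable_maxr. Qed.

Lemma measurable_clip (a b : R) : measurable_fun [set: R] (clip a b).
Proof.
apply: measurable_funM => //; apply: measurable_funB;
by apply: (measurableT_comp measurable_relu); apply: measurable_funB.
Qed.

Lemma measurable_staircase (c : nat -> R) n : measurable_fun [set: R] (staircase c n).
Proof. by apply: measurable_sum => k; exact: measurable_clip. Qed.

Lemma measurable_iter_tent m : measurable_fun [set: R] (iter m (@tent R)).
Proof.
elim: m => [|m IH]; first exact: measurable_id.
apply: (@measurableT_comp _ _ _ _ _ _ (@tent R) _ (iter m (@tent R))) => //.
apply: measurable_funB; apply: measurable_funM => //; first exact: measurable_relu.
by apply: (measurableT_comp measurable_relu); apply: measurable_funB.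
Qed.

Lemma measurable_net1 n (c : nat -> R) : measurable_fun [set: R] (net1 n c).
Proof. by apply: measurable_funM => //; exact: measurable_staircase. Qed.

Lemma measurable_net2 n (c : nat -> R) d m : measurable_fun [set: R] (net2 n c d m).
Proof.
apply: measurable_sum => k; apply: measurable_funM => //.
apply: (measurableT_comp (measurable_staircase (d k) n)).
apply: (measurableT_comp (measurable_iter_tent m)); exact: measurable_clip.
Qed.

End NetworkMeasurable.

(** * The histogram measure, cell by cell and strip by strip *)

Section HistogramMeasure.
Context {R : realType}.
Notation mu := (@lebesgue_measure R).
Variables (n : nat) (B : set (R * R)).
Hypotheses (n_gt0 : (0 < n)%N) (mB : measurable B).

Definition grid_itv (k : nat) : set R := `[k%:R / n%:R, k.+1%:R / n%:R].

Definition grid_cell (k l : nat) : set (R * R) := grid_itv k `*` grid_itv l.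

Local Open Scope ereal_scope.

Lemma integral_grid_itv (k : nat) (f : R -> \bar R) :
  measurable_fun [set: R] f -> (forall x, 0 <= f x) ->
  \int[mu]_(x in grid_itv k) f x =
  (n%:R^-1)%:E * \int[mu]_(t in `]0%R, 1%R[) f ((k%:R + t) / n%:R)%R.
Proof.
move=> mf f0; have n0 : (0 < n%:R :> R)%R by rewrite ltr0n.
rewrite integral_itv_bndoo //; last exact: measurable_funTS.
rewrite ge0_integral_itv_affine ?ltr_pM2r ?invr_gt0 ?ltr_nat //.
have -> : (k.+1%:R / n%:R - k%:R / n%:R = n%:R^-1 :> R)%R.
  by rewrite -mulrBl -natr1 addrAC subrr add0r mul1r.
by congr (_ * _); apply: eq_integral => t _; congr (f _); ring.
Qed.

Lemma measurable_grid_cell k l : measurable (grid_cell k l).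
Proof. by apply: measurableX; exact: measurable_itv. Qed.

Lemma measurable_indic_section (g : R * R -> R * R) :
  measurable_fun setT g -> measurable_fun setT (fun z => (\1_B (g z))%:E : \bar R).
Proof.
move=> mg; apply/measurable_EFinP.
by apply: (measurableT_comp _ mg); exact: measurable_indic.
Qed.

(** Each cell is cut into [M] vertical strips. The vertical variable [t] is integrated outside,
    matching the network side, where [t] comes from the input and [v] from the resampling. *)
Lemma product_measure_grid_cell (k l M : nat) : (0 < M)%N ->
  (mu \x mu) (grid_cell k l `&` B) =
  \sum_(j < M) (n%:R ^- 2 / M%:R)%:E *
    \int[mu]_(t in `]0%R, 1%R[) \int[mu]_(v in `]0%R, 1%R[)
      (\1_B ((k%:R + (j%:R + v) / M%:R) / n%:R, (l%:R + t) / n%:R)%R)%:E.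
Proof.
move=> M0; have mC := measurableI _ _ (measurable_grid_cell k l) mB.
have n0 : (0 < n%:R :> R)%R by rewrite ltr0n.
have M0' : (0 < M%:R :> R)%R by rewrite ltr0n.
rewrite -[X in _ X = _]setIT -integral_indic // fubini_tonelli2 //; last first.
  by apply/measurable_EFinP; exact: measurable_indic.
pose g (j : nat) (z : R * R) : R * R :=
  ((k%:R + (j%:R + z.2) / M%:R) / n%:R, z.1)%R.
have mg j : measurable_fun setT (g j).
  apply/measurable_fun_pairP; split; last exact: measurable_fst.
  apply: measurable_funM => //; apply: measurable_funD => //.
  apply: measurable_funM => //; apply: measurable_funD => //; exact: measurable_snd.
pose H (j : nat) (y : R) := \int[mu]_(v in `]0%R, 1%R[) (\1_B (g j (y, v)))%:E.
have H0 j y : 0 <= H j y by apply: integral_ge0 => v _; rewrite lee_fin.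
have mH j : measurable_fun [set: R] (H j).
  apply: (@measurable_fun_integral01 _ (fun z => (\1_B (g j z))%:E)).
    exact: measurable_indic_section.
  by move=> z; rewrite lee_fin.
(* The indicator of the cell is absorbed into the two ranges of integration. *)
transitivity (\int[mu]_(y in grid_itv l)
   \int[mu]_(x in grid_itv k) (\1_B (x, y))%:E).
  rewrite [RHS]integral_mkcond; apply: eq_integral => y _.
  rewrite /fubini_G patchE; case: ifPn => yl.
    rewrite [RHS]integral_mkcond; apply: eq_integral => x _; rewrite patchE.
    rewrite /= indicE in_setI /grid_cell in_setX /= yl andbT.
    by case: ifP; rewrite ?indicE.
  apply: integral0_eq => x _; rewrite /= indicE in_setI /grid_cell in_setX /=.
  by rewrite (negbTE yl) andbF.
have innerE (y : R) : \int[mu]_(x in grid_itv k) (\1_B (x, y))%:E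
    = \sum_(j < M) ((n%:R * M%:R)^-1)%:E * H j y.
  have mBy : measurable_fun [set: R] (fun x => (\1_B (x, y))%:E : \bar R).
    have mp : measurable_fun [set: R] (fun x : R => (x, y)).
      by apply/measurable_fun_pairP; split; [exact: measurable_id|exact: measurable_cst].
    by apply/measurable_EFinP; apply: (measurableT_comp _ mp); exact: measurable_indic.
  rewrite (integral_grid_itv k mBy) //.
  pose f1 (t : R) : \bar R := (\1_B ((k%:R + t) / n%:R, y)%R)%:E.
  have mf1 : measurable_fun [set: R] f1.
    rewrite /f1 (_ : (fun t => _) = fun t => (\1_B (k%:R / n%:R + n%:R^-1 * t, y)%R)%:E).
      exact: (measurable_comp_affine _ _ mBy).
    by apply/funext => t; congr ((\1_B (_, _))%:E); ring.
  have f1_ge0 t : 0 <= f1 t by rewrite lee_fin.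
  rewrite (ge0_integral_equipartition M0 mf1) // ge0_sume_distrr; last first.
    move=> j _; rewrite mule_ge0 ?lee_fin ?invr_ge0 //.
    by apply: integral_ge0 => t _; rewrite lee_fin.
  by apply: eq_bigr => j _; rewrite muleA -EFinM invfM.
under eq_integral do rewrite innerE.
rewrite integral_grid_itv; last 2 first.
- by apply: emeasurable_sum => j; apply: measurable_funeM.
- by move=> y; apply: sume_ge0 => j _; rewrite mule_ge0 // lee_fin invr_ge0 mulr_ge0.
have mHl j : measurable_fun [set: R] (fun t => H j ((l%:R + t) / n%:R)%R).
  rewrite (_ : (fun t => _) = fun t => H j (l%:R / n%:R + n%:R^-1 * t)%R).
    exact: measurable_comp_affine.
  by apply/funext => t; congr (H j _); ring.
rewrite ge0_integral_sum //; last 2 first.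
- by move=> j; apply: measurable_funeM; apply: measurable_funTS; exact: mHl.
- by move=> j t _; rewrite mule_ge0 // lee_fin invr_ge0 mulr_ge0.
rewrite ge0_sume_distrr; last first.
  move=> j _; apply: integral_ge0 => t _.
  by rewrite mule_ge0 // lee_fin invr_ge0 mulr_ge0.
apply: eq_bigr => j _; rewrite ge0_integralZl //; last exact: (measurable_funTS (mHl j)).
rewrite muleA -EFinM; congr (_%:E * _).
by rewrite invfM mulrA expr2 invfM.
Qed.

(** Linearity alone gives an exact formula, even though neighbouring closed cells share edges. *)
Lemma hist_measureE (w : 'I_n -> 'I_n -> R) :
  (forall k l, 0 <= w k l)%R ->
  hist_measure w B =
  \sum_(k < n) \sum_(l < n) (w k l)%:E * (mu \x mu) (grid_cell k l `&` B).
Proof.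
move=> w0; rewrite /hist_measure /hist_density.
under eq_integral => z _.
  rewrite -sumEFin.
  under eq_bigr => k _ do rewrite -sumEFin.
  over.
have mcell (k l : nat) : measurable_fun B (fun z => (\1_(grid_cell k l) z)%:E : \bar R).
  apply: measurable_funTS; apply/measurable_EFinP.
  exact: measurable_indic (measurable_grid_cell k l).
rewrite /= ge0_integral_sum //; last 2 first.
- move=> k; apply: emeasurable_sum => l.
  under eq_fun do rewrite EFinM.
  exact: (measurable_funeM (w k l)%:E (mcell k l)).
- by move=> k z _; apply: sume_ge0 => l _; rewrite lee_fin mulr_ge0.
apply: eq_bigr => k _; rewrite ge0_integral_sum //; last 2 first.
- move=> l; under eq_fun do rewrite EFinM.
  exact: (measurable_funeM (w k l)%:E (mcell k l)).
- by move=> l z _; rewrite lee_fin mulr_ge0.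
apply: eq_bigr => l _.
under eq_integral do rewrite EFinM.
rewrite ge0_integralZl ?lee_fin //; last exact: mcell.
by rewrite integral_indic //; exact: measurable_grid_cell.
Qed.

End HistogramMeasure.

(** * Knots taken from the cumulative masses of the histogram *)

Section Knots.
Variables (R : realType) (n : nat) (w : nat -> nat -> R).
Hypotheses (n_gt0 : (0 < n)%N) (w_gt0 : forall k l, 0 < w k l).

Definition column_mass k : R := \sum_(l < n) w k l.

(** Distribution function of the first marginal at [k / n]; a cell has area [1 / n^2], hence the
    divisor. *)
Definition column_knot k : R := (\sum_(i < k) column_mass i) / n%:R ^+ 2.

(** Conditional distribution function of the second coordinate at [l / n], given column [k]. *)
Definition cell_knot k l : R := (\sum_(i < l) w k i) / column_mass k.

Lemma column_mass_gt0 k : 0 < column_mass k.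
Proof.
rewrite /column_mass (bigD1 (Ordinal n_gt0)) //=.
by rewrite ltr_pwDl // sumr_ge0 // => i _; exact: ltW.
Qed.

Lemma column_knot_diff k :
  column_knot k.+1 - column_knot k = column_mass k / n%:R ^+ 2.
Proof. by rewrite /column_knot big_ord_recr /= mulrDl addrAC subrr add0r. Qed.

Lemma cell_knot_diff k l : cell_knot k l.+1 - cell_knot k l = w k l / column_mass k.
Proof. by rewrite /cell_knot big_ord_recr /= mulrDl addrAC subrr add0r. Qed.

Lemma column_knotS k : column_knot k < column_knot k.+1.
Proof.
rewrite -subr_gt0 column_knot_diff divr_gt0 ?column_mass_gt0 //.
by rewrite exprn_gt0 // ltr0n.
Qed.

Lemma cell_knotS k l : cell_knot k l < cell_knot k l.+1.
Proof. by rewrite -subr_gt0 cell_knot_diff divr_gt0 ?column_mass_gt0. Qed.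

Lemma column_knot0 : column_knot 0 = 0.
Proof. by rewrite /column_knot big_ord0 mul0r. Qed.

Lemma cell_knot0 k : cell_knot k 0 = 0.
Proof. by rewrite /cell_knot big_ord0 mul0r. Qed.

Lemma cell_knotn k : cell_knot k n = 1.
Proof. by rewrite /cell_knot divff // gt_eqF // column_mass_gt0. Qed.

Lemma column_knotn :
  \sum_(k < n) \sum_(l < n) w k l = (n ^ 2)%:R -> column_knot n = 1.
Proof.
by move=> wn; rewrite /column_knot wn natrX divff // expf_eq0 /= pnatr_eq0 -lt0n.
Qed.

End Knots.

(** * Assembly of the network and the error bound *)

Theorem mainTheorem8 (R : realType) (n s : nat) (w : 'I_n -> 'I_n -> R) :
  (0 < n)%N ->
  (forall k1 k2, 0 < w k1 k2) ->
  \sum_(k1 < n) \sum_(k2 < n) w k1 k2 = (n ^ 2)%:R ->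
  exists Psi : seq (layer R),
    [/\ is_net 1 2 Psi,
        (connectivity Psi < 88 * (n ^ 2 + n * s))%N,
        depth Psi = (s + 5)%N &
        (wasserstein1 (pushforward (@unif01 R) (realize12 Psi)) (hist_measure w)
          <= (2 * Num.sqrt 2 / (n%:R * 2 ^+ s))%:E)%E].
Proof.
(* Indices from [n] on are sent to 0, so the extended weights stay positive and the knots increase
   strictly at every natural index. *)
move=> n_gt0 w_gt0 w_sum; pose ord (k : nat) : 'I_n := insubd (Ordinal n_gt0) k.
pose v k l : R := w (ord k) (ord l).
have vE (k l : 'I_n) : v k l = w k l by rewrite /v /ord !valKd.
have v_gt0 k l : 0 < v k l by exact: w_gt0.
have v_sum : \sum_(k < n) \sum_(l < n) v k l = (n ^ 2)%:R.
  by rewrite -w_sum; apply: eq_bigr => k _; apply: eq_bigr => l _.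
pose c := column_knot n v; pose d := cell_knot n v.
have cS : forall k, c k < c k.+1 by exact: column_knotS.
have dS : forall k l, d k l < d k l.+1 by exact: cell_knotS.
have c0 : c 0 = 0 by exact: column_knot0.
have d0 : forall k, d k 0 = 0 by exact: cell_knot0.
have cn : c n = 1 by exact: column_knotn.
have dn : forall k, d k n = 1 by exact: cell_knotn.
exists (network n c d s); split.
- exact: is_net_network.
- exact: connectivity_network.
- exact: depth_network.
have -> : realize12 (network n c d s) = fun u => (net1 n c u, net2 n c d s.+1 u).
  by apply/funext => u; exact: realize_network.
have N0 : (0 < n * 2 ^ s.+1)%N by rewrite muln_gt0 n_gt0 expn_gt0.
have M0 : (0 < 2 ^ s.+1)%N by rewrite expn_gt0.
have net1_ge0 u : 0 <= net1 n c u by rewrite divr_ge0 ?staircase_ge0.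
have mX := measurable_net1 n c; have mY := measurable_net2 n c d s.+1.
apply: le_trans (wasserstein1_strip mX mY net1_ge0 N0 _) _.
  move=> B mB; pose f (z : R * R) : \bar R :=
    (\1_B (strip_point (net1 n c) (net2 n c d s.+1) (n * 2 ^ s.+1) z))%:E.
  have mf : measurable_fun setT f.
    apply/measurable_EFinP; apply: (measurableT_comp _ (measurable_strip_point _ mX mY)).
    exact: measurable_indic.
  have f0 z : (0 <= f z)%E by rewrite lee_fin.
  rewrite (ge0_integral_cells s.+1 cS c0 cn dS d0 dn (measurable_fun_integral01 mf f0)); last first.
    by move=> u; apply: integral_ge0 => y _.
  rewrite hist_measureE //; last by move=> k l; exact: ltW.
  (* The network side sums over branches before cells; the histogram side cuts each cell into
     strips. *)
  apply: eq_bigr => k _; rewrite exchange_big /=; apply: eq_bigr => l _.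
  rewrite (product_measure_grid_cell n_gt0 mB k l M0) ge0_sume_distrr; last first.
    move=> j _; rewrite mule_ge0 // ?lee_fin ?divr_ge0 ?invr_ge0 ?exprn_ge0 //.
    by apply: integral_ge0 => t _; apply: integral_ge0 => y _; rewrite lee_fin.
  (* The column mass cancels: both weights are [w k l / (n^2 * 2^(s+1))]. *)
  apply: eq_bigr => j _; rewrite muleA -EFinM; congr (_%:E * _)%E.
    have m0 := column_mass_gt0 n_gt0 v_gt0 k.
    rewrite column_knot_diff cell_knot_diff vE natrX; field.
    by rewrite (gt_eqF m0) pnatr_eq0 -lt0n n_gt0 !andbT gt_eqF // exprn_gt0.
  apply: eq_integral => t; rewrite inE /= in_itv /= => t01.
  apply: eq_integral => y _; rewrite /f.
  by rewrite (@strip_cell_point _ _ _ _ _ _ cS dS d0 dn) // natrX.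
(* The coupling costs at most [1 / (n * 2^(s+1))], and 1/2 is below the allowed factor
   [2 * Num.sqrt 2]. *)
rewrite lee_fin natrM natrX exprS.
have sqrt2 : 1 <= Num.sqrt 2 :> R by rewrite -[leLHS]sqrtr1 ler_sqrt ?ler1n.
have D0 : 0 < n%:R * 2 ^+ s :> R by rewrite mulr_gt0 ?ltr0n ?exprn_gt0.
rewrite mulrCA invfM; apply: ler_pM; rewrite ?invr_ge0 ?(ltW D0) //.
by rewrite -div1r ler_pdivrMr //; lra.
Qed.
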